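(* Let $\mathrm{Aff}^+(\mathbb{R})$ be the Lie group of orientation preserving affine transformations $f(s)=xs+y$ ($x>0$, $y\in\mathbb{R}$) of the real line. A left-invariant semi-Riemannian metric $g$ on $\mathrm{Aff}^+(\mathbb{R})$ is geodesically complete if and only if $g$ is (positive or negative) definite.
   Context: $\mathrm{Aff}^+(\mathbb{R})$ is identified with the group of matrices $\begin{pmatrix} x & y\\ 0& 1\end{pmatrix}$ with $x>0$, $y\in\mathbb{R}$. A semi-Riemannian metric is a smooth non-degenerate symmetric 2-tensor field of constant (arbitrary) signature; it is geodesically complete if all its inextensible geodesics are defined on all of $\mathbb{R}$. *)

(* Defs.v *)
From HB Require Import structures.
From mathcomp Require Import all_boot all_order all_algebra.
From mathcomp Require Import all_classical all_reals all_analysis.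
Set Implicit Arguments.
Unset Strict Implicit.
Unset Printing Implicit Defensive.
Import Order.TTheory GRing.Theory Num.Theory.
Import numFieldNormedType.Exports.
Local Open Scope ring_scope.
Local Open Scope classical_set_scope.

(* Manifolds here are open subsets U of R^n, with the global chart given by the
   inclusion. A tensor field of type (0, 2) is given by its Gram matrices
   g p = (g_p(e_i, e_j))_ij in the coordinate frame; its values outside U are
   irrelevant, since all conditions below only involve germs at points of U. *)

Section BilinearForms.
Context {R : realType} {n : nat}.
Implicit Types B W : 'M[R]_n.

Definition bilin B (u v : 'rV[R]_n) : R := (u *m B *m v^T) 0 0.

Definition nondegenerate B :=
  forall u, (forall v, bilin B u v = 0) -> u = 0.

Definition pos_def B := forall v, v != 0 -> 0 < bilin B v v.

Definition neg_def B := forall v, v != 0 -> bilin B v v < 0.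

(* the row space of W is a subspace on which B is negative definite *)
Definition neg_def_on B W :=
  forall v : 'rV[R]_n, (v <= W)%MS -> v != 0 -> bilin B v v < 0.

(* For B symmetric and nondegenerate the signature is (n - k, k), where k is
   the maximal dimension of a subspace on which B is negative definite. *)
Definition has_index B (k : nat) :=
  (exists2 W, neg_def_on B W & \rank W = k) /\
  (forall W, neg_def_on B W -> (\rank W <= k)%N).

End BilinearForms.

Section SemiRiemannian.
Context {R : realType} {n : nat}.
Implicit Types (U : set 'rV[R]_n) (g : 'rV[R]_n -> 'M[R]_n).

Definition partial (i : 'I_n) (f : 'rV[R]_n -> R) : 'rV[R]_n -> R :=
  'D_(delta_mx 0 i) f.

Fixpoint Ck (k : nat) U (f : 'rV[R]_n -> R) : Prop :=
  (forall p, U p -> {for p, continuous f}) /\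
  if k is k'.+1 then
    forall i, (forall p, U p -> derivable f p (delta_mx 0 i)) /\
              Ck k' U (partial i f)
  else True.

Definition smooth U (f : 'rV[R]_n -> R) := forall k, Ck k U f.

Definition semi_riemannian_metric U g :=
  [/\ forall i j, smooth U (fun p => g p i j),
      forall p, U p -> (g p)^T = g p,
      forall p, U p -> nondegenerate (g p)
    & exists k, forall p, U p -> has_index (g p) k].

Definition definite_metric U g :=
  (forall p, U p -> pos_def (g p)) \/ (forall p, U p -> neg_def (g p)).

(* Christoffel symbols Gamma^k_ij of the Levi-Civita connection of g *)
Definition christoffel g (k i j : 'I_n) (p : 'rV[R]_n) : R :=
  2^-1 * \sum_l invmx (g p) k l *
    (partial i (fun q => g q j l) p + partial j (fun q => g q i l) p
     - partial l (fun q => g q i j) p).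

Definition smooth_curve (I : set R) (c : R -> 'rV[R]_n) :=
  forall k t, I t -> derivable (derive1n k c) t 1.

(* Geodesics are parametrised by nonempty open intervals I; the values of c
   outside I are irrelevant. *)
Definition geodesic U g (I : set R) (c : R -> 'rV[R]_n) :=
  [/\ I !=set0, open I & is_interval I] /\
  [/\ forall t, I t -> U (c t),
      smooth_curve I c
    & forall t, I t -> forall k,
        derive1n 2 c t 0 k +
        \sum_i \sum_j christoffel g k i j (c t) * derive1 c t 0 i * derive1 c t 0 j
        = 0].

Definition inextensible_geodesic U g (I : set R) (c : R -> 'rV[R]_n) :=
  geodesic U g I c /\
  forall J d, geodesic U g J d -> I `<=` J -> (forall t, I t -> d t = c t) -> J = I.

Definition geodesically_complete U g :=
  forall I c, inextensible_geodesic U g I c -> I = setT.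

End SemiRiemannian.

Section AffineGroup.
Context {R : realType}.
Implicit Types p q : 'rV[R]_2.

(* The affine map s |-> x s + y is encoded by its coordinates (x, y), so that
   Aff^+(R) is the open half-plane x > 0. *)
Definition affp : set 'rV[R]_2 := [set p | 0 < p 0 0].

Definition aff_map p (s : R) : R := p 0 0 * s + p 0 1.

Definition aff_mul p q : 'rV[R]_2 :=
  \row_(i < 2) (if i == 0 then p 0 0 * q 0 0 else p 0 0 * q 0 1 + p 0 1).

Lemma aff_map_mul p q : aff_map (aff_mul p q) = aff_map p \o aff_map q.
Proof.
by apply/funext => s; rewrite /aff_map /= !mxE /= mulrDr mulrA addrA.
Qed.

Lemma affp_mul p q : affp p -> affp q -> affp (aff_mul p q).
Proof. by rewrite /affp /= !mxE /=; exact: mulr_gt0. Qed.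

Definition aff_mx p : 'M[R]_2 :=
  \matrix_(i, j) if i == 0 then p 0 j else (j == 1)%:R.

Lemma aff_mx_mul p q : aff_mx (aff_mul p q) = aff_mx p *m aff_mx q.
Proof.
apply/matrixP => i j; rewrite !mxE !big_ord_recl big_ord0 !mxE /= addr0.
case: (splitP (i : 'I_(1 + 1))) => a; rewrite ord1 => ia.
- have -> : i = 0 by apply/val_inj.
  rewrite /= (_ : lift _ _ = 1); last exact/val_inj.
  case: (splitP (j : 'I_(1 + 1))) => b; rewrite ord1 => jb.
  + by have -> : j = 0 by [apply/val_inj]; rewrite /= mulr0 addr0.
  + by have -> : j = 1 by [apply/val_inj]; rewrite /= mulr1.
- have -> : i = 1 by apply/val_inj.
  by rewrite /= mul0r add0r mul1r.
Qed.

(* The left translations L_a : p |-> a p are isometries of g. *)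
Definition left_invariant (g : 'rV[R]_2 -> 'M[R]_2) :=
  forall a p, affp a -> affp p -> forall u v,
    bilin (g (aff_mul a p)) ('d (aff_mul a) p u) ('d (aff_mul a) p v) =
    bilin (g p) u v.

End AffineGroup.

(* Main.v *)
Require Import Defs.
From mathcomp Require Import all_boot all_order all_algebra.
From mathcomp Require Import all_classical all_reals all_analysis.
From mathcomp Require Import ring lra.
Set Implicit Arguments.
Unset Strict Implicit.
Unset Printing Implicit Defensive.
Import Order.TTheory GRing.Theory Num.Theory.
Import numFieldNormedType.Exports.
Local Open Scope ring_scope.
Local Open Scope classical_set_scope.

(** The left translation by [p] is affine with linear part the scaling by its
    first coordinate x, so a left-invariant metric is B / x^2 for a constant
    symmetric matrix B, the Gram matrix at the identity
    ([left_invariant_scale]). In terms of the velocity z in the left-invariant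
    frame, a curve c with first coordinate x is a geodesic iff
    c' = x z and z_k' = z_0 z_k - (B^-1)_k0 B(z, z)
    ([geodesic_euler_arnold], [euler_arnold_geodesic]). Everything depends on
    the sign of det B, which is nonzero.

    If det B < 0, then B is indefinite. Let n be an isotropic vector with first
    coordinate 1. On isotropic vectors the equation for z is z' = z_0 z, which
    is solved by z = c = (- 1 / t) n. This geodesic lives on t < 0
    and runs to infinity in finite time ([det2_lt0_incomplete]).

    If det B > 0, then B is definite, and a linear change of the second coordinate
    reduces the system to the hyperbolic half-plane: u' = - w^2, w' = u w,
    x' = x u, y' = x w. With the constant k^2 = u^2 + w^2 this gives
    (1 / x)'' = k^2 / x, a linear equation whose solutions are global, and w / x is
    constant, so that y is found by integration ([half_plane_flow_complete]).
    Hence every geodesic is a restriction of an explicit one defined on the whole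
    line ([det2_gt0_complete]). *)

(** * Differentiation on an interval *)

Section Calculus.
Context {R : realType}.
Implicit Types (I : set R) (f g : R -> R).

Lemma is_derive_rowP n (c : R -> 'rV[R]_n) (t : R) (v : 'rV[R]_n) :
  is_derive t 1 c v <-> forall k, is_derive t 1 (fun s => c s 0 k) (v 0 k).
Proof.
split=> [[cd <-] k|cd].
- split; first by move/derivable_mxP : cd; exact.
  by rewrite derive_mx// mxE.
- have dc : derivable c t 1.
    by apply/derivable_mxP => i j; rewrite (ord1 i); case: (cd j).
  split=> //; rewrite derive_mx//; apply/rowP => k.
  by rewrite mxE; case: (cd k).
Qed.

(** The rules below leave the value of the derivative as an equation, so that
    it can be put in the shape that the differential equation at hand asks for. *)
Lemma is_derive_mul f g (t : R) df dg d :
  is_derive t 1 f df -> is_derive t 1 g dg -> f t * dg + g t * df = d ->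
  is_derive t 1 (fun s => f s * g s) d.
Proof. by move=> fd gd <-; exact: is_deriveM. Qed.

Lemma is_derive_add f g (t : R) df dg d :
  is_derive t 1 f df -> is_derive t 1 g dg -> df + dg = d ->
  is_derive t 1 (fun s => f s + g s) d.
Proof. by move=> fd gd <-; exact: is_deriveD. Qed.

Lemma is_derive_sub f g (t : R) df dg d :
  is_derive t 1 f df -> is_derive t 1 g dg -> df - dg = d ->
  is_derive t 1 (fun s => f s - g s) d.
Proof. by move=> fd gd <-; exact: is_deriveB. Qed.

Lemma is_derive_scale (a : R) f (t : R) df d :
  is_derive t 1 f df -> a * df = d -> is_derive t 1 (fun s => a * f s) d.
Proof. by move=> fd <-; exact: is_deriveZ. Qed.

Lemma is_derive_inv f (t : R) df d :
  f t != 0 -> is_derive t 1 f df -> - df / f t ^+ 2 = d ->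
  is_derive t 1 (fun s => (f s)^-1) d.
Proof.
move=> ft0 fd <-; apply: is_derive_eq (is_deriveV ft0 fd) _.
by rewrite /GRing.scale/= !mulNr mulrC.
Qed.

Lemma derive0_interval_cst I f : is_interval I ->
  (forall t, I t -> is_derive t 1 f 0) -> forall s t, I s -> I t -> f s = f t.
Proof.
move=> itvI df s t.
wlog st : s t / s <= t.
  by move=> H Is It; case: (leP s t) => [/H|/ltW /H]; [exact|move=> ->].
move=> Is It.
have dI r : r \in `[s, t]%R -> is_derive r 1 f 0.
  by rewrite in_itv/= => srt; apply: df; exact: itvI srt.
have cf : {within `[s, t], continuous f}.
  by apply: derivable_within_continuous => r /dI [].
have dI' r : r \in `]s, t[%R -> is_derive r 1 f 0.
  by move=> rst; apply: dI; exact: subset_itv_oo_cc rst.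
have [r _] := MVT_segment st dI' cf.
by rewrite mul0r => /subr0_eq.
Qed.

(** Differentiating never leaves the family [F], so all iterated derivatives
    exist; their values outside [I] are never looked at. *)
Lemma smooth_curve_closed n I (c : R -> 'rV[R]_n) (F : set (R -> R)) :
  open I ->
  (forall f, F f -> exists2 g, F g & forall t, I t -> is_derive t 1 f (g t)) ->
  (forall k, exists2 f, F f & forall t, I t -> c t 0 k = f t) ->
  smooth_curve I c.
Proof.
move=> oI clF Fc m.
have step (d : R -> 'rV[R]_n) (f f' : 'I_n -> R -> R) :
    (forall k t, I t -> d t 0 k = f k t) ->
    (forall k t, I t -> is_derive t 1 (f k) (f' k t)) ->
    forall t, I t -> is_derive t 1 d (\row_k f' k t).
  move=> df ff' t It; apply/is_derive_rowP => k; rewrite mxE.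
  apply: near_eq_is_derive (ff' k t It).
  by have := open_nbhs_nbhs (conj oI It); apply: filterS => s /df ->.
suff [f Ff fE] : exists2 f : 'I_n -> R -> R, (forall k, F (f k)) &
    forall k t, I t -> derive1n m c t 0 k = f k t.
  move=> t It.
  have /choice[f' f'P] : forall k, exists f',
      forall t, I t -> is_derive t 1 (f k) (f' t).
    by move=> k; have [f'] := clF _ (Ff k); exists f'.
  by case: (step _ _ _ fE f'P t It).
elim: m => [|m [f Ff fE]].
  have /choice[f fP] : forall k, exists f, F f /\ forall t, I t -> c t 0 k = f t.
    by move=> k; have [f] := Fc k; exists f.
  by exists f => k; case: (fP k).
have /choice[f' f'P] : forall k, exists f', F f' /\
    forall t, I t -> is_derive t 1 (f k) (f' t).
  by move=> k; have [f'] := clF _ (Ff k); exists f'.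
exists f' => [k|k t It]; first by case: (f'P k).
rewrite derive1nS derive1E.
have [_ ->] := step _ _ _ fE (fun k => (f'P k).2) t It.
by rewrite mxE.
Qed.

(** The unknowns of a polynomial system of differential equations generate a
    ring of functions that is stable under differentiation along a solution. *)
Inductive generated_ring (G : set (R -> R)) : set (R -> R) :=
| gen_base f : G f -> generated_ring G f
| gen_cst a : generated_ring G (cst a)
| gen_add f h : generated_ring G f -> generated_ring G h ->
    generated_ring G (fun t => f t + h t)
| gen_mul f h : generated_ring G f -> generated_ring G h ->
    generated_ring G (fun t => f t * h t).

Lemma generated_ring_derive I (G : set (R -> R)) :
  (forall f, G f -> exists2 f', generated_ring G f' &
     forall t, I t -> is_derive t 1 f (f' t)) ->
  forall f, generated_ring G f -> exists2 f', generated_ring G f' &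
     forall t, I t -> is_derive t 1 f (f' t).
Proof.
move=> dG f; elim=> {f}.
- exact: dG.
- by move=> a; exists (cst 0) => [|t _]; [exact: gen_cst|exact: is_derive_cst].
- move=> f h _ [f' Gf' df] _ [h' Gh' dh].
  exists (fun t => f' t + h' t); first exact: gen_add.
  by move=> t It; apply: is_derive_add (df t It) (dh t It) _.
- move=> f h Gf [f' Gf' df] Gh [h' Gh' dh].
  exists (fun t => f t * h' t + h t * f' t).
    by apply: gen_add; exact: gen_mul.
  by move=> t It; apply: is_derive_mul (df t It) (dh t It) _.
Qed.

End Calculus.

(** * Bilinear forms *)

Lemma ord2E (k : 'I_2) : k = 0 \/ k = 1.
Proof. by case: k => -[|[|//]] ?; [left|right]; apply/val_inj. Qed.

Lemma sum_ord2 (V : nmodType) (F : 'I_2 -> V) : \sum_i F i = F 0 + F 1.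
Proof.
by rewrite !big_ord_recl big_ord0 addr0; congr (_ + F _); apply/val_inj.
Qed.

Lemma bilin_delta (R : realType) n (B : 'M[R]_n) i j :
  bilin B (delta_mx 0 i) (delta_mx 0 j) = B i j.
Proof.
by rewrite /bilin -rowE trmx_delta -colE !mxE.
Qed.

Lemma bilinE (R : realType) n (B : 'M[R]_n) u v :
  bilin B u v = \sum_i \sum_j B i j * u 0 i * v 0 j.
Proof.
rewrite /bilin mxE exchange_big/=; apply: eq_bigr => j _.
rewrite !mxE mulr_suml; apply: eq_bigr => i _.
by rewrite (mulrC (u 0 i)).
Qed.

Lemma bilinZl (R : realType) n (a : R) (B : 'M[R]_n) u v :
  bilin (a *: B) u v = a * bilin B u v.
Proof. by rewrite /bilin -scalemxAr -scalemxAl mxE. Qed.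

Lemma bilinZZ (R : realType) n (a : R) (B : 'M[R]_n) u v :
  bilin B (a *: u) (a *: v) = a ^+ 2 * bilin B u v.
Proof.
by rewrite /bilin linearZ/= -!scalemxAl -scalemxAr !mxE mulrA expr2.
Qed.

Lemma nondegenerate_unitmx (R : realType) n (B : 'M[R]_n) :
  Defs.nondegenerate B -> B \in unitmx.
Proof.
move=> ndB; rewrite -row_free_unit; apply: inj_row_free => u uB0.
by apply: ndB => v; rewrite /bilin uB0 mul0mx mxE.
Qed.

Section BinaryForms.
Context {R : realType}.
Implicit Types B : 'M[R]_2.

(** The determinant of a symmetric [B]; its sign decides definiteness. *)
Definition det2 B := B 0 0 * B 1 1 - B 0 1 ^+ 2.

Lemma sym_offdiag B : B^T = B -> B 1 0 = B 0 1.
Proof. by move=> symB; rewrite -[in LHS]symB mxE. Qed.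

Lemma bilin2E B (v : 'rV[R]_2) : B^T = B -> bilin B v v =
  B 0 0 * v 0 0 ^+ 2 + 2 * B 0 1 * v 0 0 * v 0 1 + B 1 1 * v 0 1 ^+ 2.
Proof.
by move=> /sym_offdiag BE; rewrite bilinE !sum_ord2 BE; ring.
Qed.

Lemma bilin2_square B (v : 'rV[R]_2) : B^T = B -> B 1 1 * bilin B v v =
  (B 1 1 * v 0 1 + B 0 1 * v 0 0) ^+ 2 + det2 B * v 0 0 ^+ 2.
Proof. by move=> symB; rewrite bilin2E// /det2; ring. Qed.

(** If the determinant vanished, the equations B B^-1 = 1 would force the
    second column of [B] to be zero. *)
Lemma det2_neq0 B : B^T = B -> B \in unitmx -> det2 B != 0.
Proof.
move=> /sym_offdiag BE uB; apply/eqP => D0.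
have /matrixP BV := mulmxV uB.
have := BV 0 0; have := BV 1 0; have := BV 1 1; have := BV 0 1.
rewrite !mxE !sum_ord2 BE/= ?(mulr0n, mulr1n) => e01 e11 e10 e00.
have [c0 b0] : B 1 1 = 0 /\ B 0 1 = 0.
  split; rewrite -[LHS]mulr1 -e00.
  - transitivity (det2 B * invmx B 0 0
      + B 0 1 * (B 0 1 * invmx B 0 0 + B 1 1 * invmx B 1 0)).
      by rewrite /det2; ring.
    by rewrite D0 e10; ring.
  - transitivity (B 0 0 * (B 0 1 * invmx B 0 0 + B 1 1 * invmx B 1 0)
      - det2 B * invmx B 1 0).
      by rewrite /det2; ring.
    by rewrite D0 e10; ring.
by move: e11; rewrite b0 c0 !mul0r addr0 => /esym/eqP; rewrite oner_eq0.
Qed.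

(** Only this column of the inverse enters the geodesic equation, since the
    conformal factor depends on the first coordinate alone. *)
Lemma invmx_col0 B : B^T = B -> B \in unitmx ->
  invmx B 0 0 = B 1 1 / det2 B /\ invmx B 1 0 = - B 0 1 / det2 B.
Proof.
move=> symB uB; have D0 := det2_neq0 symB uB.
have /matrixP BV := mulmxV uB.
have := BV 0 0; have := BV 1 0.
rewrite !mxE !sum_ord2 (sym_offdiag symB)/= ?(mulr0n, mulr1n) => e10 e00.
split; apply: (mulIf D0); rewrite divfK//.
- transitivity (B 1 1 * (B 0 0 * invmx B 0 0 + B 0 1 * invmx B 1 0)
    - B 0 1 * (B 0 1 * invmx B 0 0 + B 1 1 * invmx B 1 0)).
    by rewrite /det2; ring.
  by rewrite e00 e10; ring.
- transitivity (B 0 0 * (B 0 1 * invmx B 0 0 + B 1 1 * invmx B 1 0)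
    - B 0 1 * (B 0 0 * invmx B 0 0 + B 0 1 * invmx B 1 0)).
    by rewrite /det2; ring.
  by rewrite e00 e10; ring.
Qed.

(** An indefinite form has two isotropic lines, and at least one of them is not
    the axis of the second coordinate. *)
Lemma isotropic_direction B : B^T = B -> det2 B < 0 ->
  exists2 n : 'rV[R]_2, n 0 0 = 1 & bilin B n n = 0.
Proof.
move=> symB D0; pose n m : 'rV[R]_2 := \row_i if i == 0 then 1 else m.
have [c0|c0] := eqVneq (B 1 1) 0.
  have b0 : B 0 1 != 0.
    by apply: contraTneq D0 => b0; rewrite /det2 c0 b0 mulr0 expr0n subrr ltxx.
  exists (n (- B 0 0 / (2 * B 0 1))); rewrite ?bilin2E// !mxE//= c0.
  by field.
exists (n ((Num.sqrt (- det2 B) - B 0 1) / B 1 1)); first by rewrite mxE.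
apply: (mulfI c0); rewrite bilin2_square// mulr0 !mxE/=.
rewrite mulrC divfK// mulr1 subrK sqr_sqrtr ?oppr_ge0 1?ltW//.
by rewrite expr1n mulr1 addNr.
Qed.

Lemma det2_gt0_diag B : 0 < det2 B -> B 1 1 != 0.
Proof.
apply: contraTneq => c0; rewrite /det2 c0 mulr0 sub0r oppr_gt0 -leNgt.
exact: sqr_ge0.
Qed.

Lemma det2_gt0_form B (v : 'rV[R]_2) : B^T = B -> 0 < det2 B -> v != 0 ->
  0 < B 1 1 * bilin B v v.
Proof.
move=> symB D0 v0; rewrite bilin2_square//.
have w2 := sqr_ge0 (B 1 1 * v 0 1 + B 0 1 * v 0 0).
have Dv2 : 0 <= det2 B * v 0 0 ^+ 2 by rewrite mulr_ge0 ?sqr_ge0// ltW.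
rewrite lt_neqAle addr_ge0// andbT eq_sym paddr_eq0//.
apply: contraNN v0.
rewrite [det2 B * _ == 0]mulf_eq0 (gt_eqF D0) !sqrf_eq0/= => /andP[/eqP + /eqP v00].
rewrite v00 mulr0 addr0 => /eqP; rewrite mulf_eq0 (negPf (det2_gt0_diag D0))/=.
by move=> /eqP v01; apply/eqP/rowP => i; rewrite mxE; case: (ord2E i) => ->.
Qed.

End BinaryForms.

(** * Left-invariant metrics *)

Section LeftInvariant.
Context {R : realType}.
Implicit Types (p : 'rV[R]_2) (g : 'rV[R]_2 -> 'M[R]_2).

Definition aff_one : 'rV[R]_2 := delta_mx 0 0.

Lemma diff_aff_mul p q u : 'd (aff_mul p) q u = p 0 0 *: u.
Proof.
have -> : aff_mul p = p 0 0 *: id + cst (p 0 1 *: delta_mx 0 1).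
  apply/funext => r; apply/rowP => i; rewrite fctE !mxE.
  by case: (ord2E i) => ->; rewrite /= ?mulr0 ?addr0 ?mulr1.
by rewrite diff_val fctE/= addr0.
Qed.

(** The left translation by [p] maps the identity to [p], and it is affine with
    linear part the scaling by the first coordinate of [p]. *)
Lemma left_invariant_scale g p : left_invariant g -> affp p ->
  g p = (p 0 0) ^- 2 *: g aff_one.
Proof.
move=> g_inv p0.
have p0' : p 0 0 != 0 by rewrite gt_eqF.
have e0 : affp aff_one by rewrite /affp/= mxE eqxx ltr01.
have pE : aff_mul p aff_one = p.
  apply/rowP => i; rewrite !mxE/= mulr1 mulr0 add0r.
  by case: (ord2E i) => ->.
apply/matrixP => i j; rewrite mxE -!bilin_delta -(g_inv _ _ p0 e0) pE.
by rewrite !diff_aff_mul bilinZZ mulrA mulVf ?mul1r// expf_neq0.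
Qed.

(** By homogeneity the Gram matrix is the constant matrix [g aff_one] divided
    by the square of the first coordinate, so only that coordinate contributes. *)
Lemma partial_gram g i j l p : left_invariant g -> affp p ->
  partial l (fun q => g q i j) p =
  - 2 * (l == 0)%:R * (p 0 0) ^- 3 * g aff_one i j.
Proof.
move=> g_inv p0.
have p0' : p 0 0 != 0 by rewrite gt_eqF.
pose G (q : 'rV[R]_2) := g aff_one i j * (q 0 0) ^- 2.
have nU : \near p, G p = g p i j.
  have oU : \forall q \near p, affp q.
    have cp : (q : 'rV[R]_2) 0 0 @[q --> p] --> p 0 0.
      exact: coord_continuous.
    exact: (cvgr_gt _ cp).
  by near=> q; rewrite left_invariant_scale// ?mxE 1?mulrC//; near: q.
rewrite /partial -(near_eq_derive _ nU).
have D0 : is_derive p (delta_mx 0 l) (fun q : 'rV[R]_2 => q 0 0) (l == 0)%:R.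
  have [did Did] := is_derive_id p (delta_mx 0 l).
  split; first by move/derivable_mxP : did; exact.
  have := derive_mx did; rewrite Did => /matrixP/(_ 0 0).
  by rewrite !mxE eqxx eq_sym => <-.
have D2 := is_deriveX 2 D0.
have p20 : (p 0 0) ^+ 2 != 0 by rewrite expf_neq0.
have DV : is_derive p (delta_mx 0 l) (fun q : 'rV[R]_2 => (q 0 0 ^+ 2)^-1)
    (- (p 0 0 ^+ 2) ^- 2 *: ((2 * p 0 0 ^+ 2.-1) *: (l == 0)%:R)).
  case: D2 => d2 E2; split; first exact: derivableV.
  by rewrite deriveV// E2.
have [_ ->] := is_deriveZ (g aff_one i j) DV.
by rewrite /GRing.scale/=; field.
Unshelve. all: by end_near. Qed.

(** These are the Christoffel symbols of a constant metric rescaled by the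
    conformal factor [(p 0 0) ^- 2]. *)
Lemma christoffel_left_invariant g k i j p :
  left_invariant g -> g aff_one \in unitmx -> (g aff_one)^T = g aff_one ->
  affp p ->
  christoffel g k i j p =
  - (p 0 0)^-1 * ((i == 0)%:R * (j == k)%:R + (j == 0)%:R * (i == k)%:R
                  - invmx (g aff_one) k 0 * g aff_one i j).
Proof.
move=> g_inv; set B := g aff_one => uB symB p0.
have p0' : p 0 0 != 0 by rewrite gt_eqF.
have BV i' : \sum_l invmx B k l * B i' l = (i' == k)%:R.
  have := mulVmx uB => /matrixP/(_ k i'); rewrite !mxE eq_sym => <-.
  by apply: eq_bigr => l _; congr (_ * _); rewrite -{1}symB mxE.
rewrite /christoffel left_invariant_scale// -/B invmxZ; last first.
  by rewrite unitmxZ// unitfE invr_eq0 expf_neq0.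
rewrite -(BV j) -(BV i).
have -> : invmx B k 0 = \sum_l (l == 0)%:R * invmx B k l.
  by rewrite sum_ord2 mul1r mul0r addr0.
rewrite mulr_suml !mulr_sumr -big_split/= -sumrB mulr_sumr.
apply: eq_bigr => l _; rewrite !partial_gram// -/B !mxE.
by field.
Qed.

Lemma christoffel_quad g k p (z : 'rV[R]_2) :
  left_invariant g -> g aff_one \in unitmx -> (g aff_one)^T = g aff_one ->
  affp p ->
  \sum_i \sum_j christoffel g k i j p * z 0 i * z 0 j =
  - (p 0 0)^-1 * (2 * z 0 0 * z 0 k
                  - invmx (g aff_one) k 0 * bilin (g aff_one) z z).
Proof.
move=> g_inv uB symB p0.
rewrite bilinE !sum_ord2 !christoffel_left_invariant//.
by case: (ord2E k) => ->; rewrite /=; ring.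
Qed.
End LeftInvariant.

(** * The geodesic equation in the left-invariant frame *)

Section EulerArnold.
Context {R : realType}.
Implicit Types (g : 'rV[R]_2 -> 'M[R]_2) (I : set R).

(** The geodesic equation as a first-order system: [z] is the velocity of [c]
    in the left-invariant frame x d/dx, x d/dy (the velocity divided by the first
    coordinate of [c]), and the equation for [z] alone is the Euler-Arnold
    equation on the Lie algebra. *)
Definition euler_arnold (B : 'M[R]_2) I (c z : R -> 'rV[R]_2) :=
  forall t, I t -> 0 < c t 0 0 /\ forall k,
    is_derive t 1 (fun s => c s 0 k) (c t 0 0 * z t 0 k) /\
    is_derive t 1 (fun s => z s 0 k)
      (z t 0 0 * z t 0 k - invmx B k 0 * bilin B (z t) (z t)).

Lemma euler_arnold_smooth B I c z : open I -> euler_arnold B I c z ->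
  smooth_curve I c.
Proof.
move=> oI eaz.
pose G : set (R -> R) := [set f | exists k, f = (fun s => c s 0 k) \/
                                            f = (fun s => z s 0 k)].
have Gc k : generated_ring G (fun s => c s 0 k).
  by apply: gen_base; exists k; left.
have Gz k : generated_ring G (fun s => z s 0 k).
  by apply: gen_base; exists k; right.
have Gsum (f : 'I_2 -> R -> R) : (forall i, generated_ring G (f i)) ->
    generated_ring G (fun t => \sum_i f i t).
  move=> Gf; have -> : (fun t => \sum_i f i t) = fun t => f 0 t + f 1 t.
    by apply/funext => t; rewrite sum_ord2.
  exact: gen_add.
have Gq : generated_ring G (fun s => bilin B (z s) (z s)).
  under eq_fun do rewrite bilinE.
  apply: (Gsum (fun i s => _)) => i; apply: (Gsum (fun j s => _)) => j.
  by apply: gen_mul => //; apply: gen_mul => //; exact: gen_cst.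
apply: (smooth_curve_closed (F := generated_ring G)) => //; last first.
  by move=> k; exists (fun s => c s 0 k).
apply: generated_ring_derive => f [k [->|->]].
- exists (fun t => c t 0 0 * z t 0 k); first exact: gen_mul.
  by move=> t /eaz[_ /(_ k)[]].
- exists (fun t => z t 0 0 * z t 0 k + - invmx B k 0 * bilin B (z t) (z t)).
    apply: gen_add; apply: gen_mul => //; exact: gen_cst.
  by move=> t /eaz[_ /(_ k)[_]]; rewrite mulNr.
Qed.

Section Geodesics.
Context (g : 'rV[R]_2 -> 'M[R]_2) (g_inv : left_invariant g).
Context (ug : g aff_one \in unitmx) (symg : (g aff_one)^T = g aff_one).
Let B := g aff_one.

Lemma geodesic_euler_arnold I c : geodesic affp g I c ->
  exists z, euler_arnold B I c z.
Proof.
move=> [_ [cU sc geo]]; exists (fun t => (c t 0 0)^-1 *: derive1 c t) => t It.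
have x0 : 0 < c t 0 0 := cU t It.
split=> // k.
have dc i : is_derive t 1 (fun s => c s 0 i) (derive1 c t 0 i).
  move: i; apply/is_derive_rowP; rewrite derive1E.
  by apply: derivableP; exact: (sc 0 t It).
have ddc i : is_derive t 1 (fun s => derive1 c s 0 i) (derive1n 2 c t 0 i).
  move: i; apply/is_derive_rowP; rewrite derive1nS derive1E.
  by apply: derivableP; exact: (sc 1 t It).
split.
  by apply: is_derive_eq (dc k) _; rewrite mxE mulVKf// gt_eqF.
under eq_fun do rewrite mxE.
have xV := is_derive_inv (lt0r_neq0 x0) (dc 0) erefl.
apply: is_derive_mul xV (ddc k) _.
have /eqP := geo t It k; rewrite christoffel_quad//.
rewrite addr_eq0 => /eqP ->; rewrite -/B bilinZZ !mxE.
by field; rewrite gt_eqF.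
Qed.

Lemma euler_arnold_geodesic I c z :
  I !=set0 -> open I -> is_interval I -> euler_arnold B I c z ->
  geodesic affp g I c.
Proof.
move=> I0 oI itvI eaz; split=> //; split.
- by move=> t /eaz[].
- exact: euler_arnold_smooth eaz.
move=> t It k.
have dcE s : I s -> derive1 c s = c s 0 0 *: z s.
  move=> Is; rewrite derive1E.
  have [_ ->//] : is_derive s 1 c (c s 0 0 *: z s).
  by apply/is_derive_rowP => i; rewrite mxE; have [_ /(_ i)[]] := eaz s Is.
have [x0 dcz] := eaz t It.
have ddc : is_derive t 1 (derive1 c) (\row_i
   (c t 0 0 * (z t 0 0 * z t 0 i - invmx B i 0 * bilin B (z t) (z t))
    + z t 0 i * (c t 0 0 * z t 0 0))).
  apply: (@near_eq_is_derive _ _ _ (fun s => c s 0 0 *: z s)).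
    by have := open_nbhs_nbhs (conj oI It); apply: filterS => s /dcE ->.
  apply/is_derive_rowP => i; rewrite mxE; under eq_fun do rewrite mxE.
  by apply: is_derive_mul (dcz 0).1 (dcz i).2 _.
rewrite christoffel_quad//.
rewrite (_ : derive1n 2 c = derive1 (derive1 c))// derive1E.
have [_ ->] := ddc; rewrite dcE// bilinZZ !mxE -/B.
by field; rewrite gt_eqF.
Qed.
End Geodesics.

End EulerArnold.

(** * Geodesics of the hyperbolic half-plane *)

Section HalfPlane.
Context {R : realType}.
Implicit Types I : set R.

(** The fundamental solutions at [t0] of f'' = k^2 f: the hyperbolic cosine and
    sine for [k != 0], the functions 1 and t - t0 for [k = 0]. *)
Lemma hyperbolic_functions (k t0 : R) : exists C S : R -> R,
  [/\ forall t : R, is_derive t 1 C (k ^+ 2 * S t), forall t : R, is_derive t 1 S (C t),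
      C t0 = 1, S t0 = 0 & forall t, 0 < C t /\ C t ^+ 2 - k ^+ 2 * S t ^+ 2 = 1].
Proof.
have [->|k0] := eqVneq k 0.
  exists (cst 1), (fun t => t - t0); split=> [t|t|//||t]; last 2 first.
  - by rewrite subrr.
  - by split; [exact: ltr01|rewrite /=; ring].
  - by rewrite expr0n mul0r; exact: is_derive_cst.
  - by apply: is_derive_sub (is_derive_id _ _) (is_derive_cst _ _ _) _; rewrite subr0.
pose E a (t : R) := expR (a * (t - t0)).
have dE a (t : R) : is_derive t 1 (E a) (a * E a t).
  rewrite mulrC; apply: is_derive1_comp; rewrite /E.
  apply: is_derive_scale (is_derive_sub (is_derive_id _ _) (is_derive_cst _ _ _) erefl) _.
  by rewrite subr0 mulr1.
have E1 t : E k t * E (- k) t = 1 by rewrite -expRD mulNr subrr expR0.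
have E0 a : E a t0 = 1 by rewrite /E subrr mulr0 expR0.
exists (fun t => 2^-1 * (E k t + E (- k) t)).
exists (fun t => (2 * k)^-1 * (E k t - E (- k) t)); split=> [t|t|||t].
- apply: is_derive_scale (is_derive_add (dE k t) (dE (- k) t) erefl) _.
  by field.
- apply: is_derive_scale (is_derive_sub (dE k t) (dE (- k) t) erefl) _.
  by field.
- by rewrite !E0; field.
- by rewrite !E0 subrr mulr0.
- split; first by rewrite mulr_gt0 ?invr_gt0 ?addr_gt0 ?expR_gt0.
  by rewrite -[RHS](E1 t); field.
Qed.

(** The geodesic equation of the hyperbolic half-plane (dx^2 + dy^2) / x^2, with
    (u, w) the velocity in the frame x d/dx, x d/dy. *)
Definition half_plane_flow I (x y u w : R -> R) := forall t : R, I t ->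
  [/\ 0 < x t, is_derive t 1 x (x t * u t), is_derive t 1 y (x t * w t),
      is_derive t 1 u (- w t ^+ 2) & is_derive t 1 w (u t * w t)].

(** Along a solution u^2 + w^2 is a constant k^2, and 1 / x solves the linear
    equation f'' = k^2 f, which yields x explicitly. Then w / x is constant as
    well, so y is a primitive of a multiple of x^2. The denominator [e]
    below is x0 / x; it never vanishes because |u0| <= k, so the
    formulas make sense for all times. Rather than appealing to a uniqueness
    theorem, an arbitrary solution is compared to the formulas by means of
    quantities with zero derivative. *)
Lemma half_plane_flow_complete (t0 x0 y0 u0 w0 : R) : 0 < x0 ->
  exists X Y U W, half_plane_flow setT X Y U W /\
    forall I x y u w, is_interval I -> I t0 -> half_plane_flow I x y u w ->
    [/\ x t0 = x0, y t0 = y0, u t0 = u0 & w t0 = w0] ->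
    forall t, I t -> x t = X t /\ y t = Y t.
Proof.
move=> x0_gt0; pose k := Num.sqrt (u0 ^+ 2 + w0 ^+ 2).
have k2 : k ^+ 2 = u0 ^+ 2 + w0 ^+ 2 by rewrite sqr_sqrtr// addr_ge0// sqr_ge0.
have [C [S [dC dS Ct0 St0 CS]]] := hyperbolic_functions k t0.
pose e t := C t - u0 * S t.
have e_gt0 t : 0 < e t.
  have [Cgt0 CS1] := CS t; rewrite subr_gt0 ltNge; apply/negP => CuS.
  have : C t ^+ 2 <= (u0 * S t) ^+ 2 by rewrite !expr2 ler_pM// ltW.
  have := sqr_ge0 (w0 * S t); rewrite k2 in CS1; nra.
have de (t : R) : is_derive t 1 e (k ^+ 2 * S t - u0 * C t).
  exact: is_derive_sub (dC t) (is_derive_scale (dS t) erefl) erefl.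
have e0 t := lt0r_neq0 (e_gt0 t).
have x0_neq0 := lt0r_neq0 x0_gt0.
have dV a (t : R) : is_derive t 1 (fun s => a / e s)
    (a * (- (k ^+ 2 * S t - u0 * C t) / e t ^+ 2)).
  exact: is_derive_scale (is_derive_inv (e0 t) (de t) erefl) erefl.
have dY (t : R) : is_derive t 1 (fun s => w0 * x0 * (S s / e s)) (x0 / e t * (w0 / e t)).
  apply: is_derive_scale (is_derive_mul (dS t) (is_derive_inv (e0 t) (de t) erefl) erefl) _.
  apply: (@mulIf _ (e t ^+ 2)); first by rewrite expf_neq0.
  have [_ CS1] := CS t.
  transitivity (w0 * x0 * (C t ^+ 2 - k ^+ 2 * S t ^+ 2)); last first.
    by rewrite CS1; field.
  by move: (e0 t); rewrite /e => et0; field.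
exists (fun t => x0 / e t), (fun t => y0 + w0 * x0 * (S t / e t)).
exists (fun t => (u0 * C t - k ^+ 2 * S t) / e t), (fun t => w0 / e t); split.
  move=> t _; split.
  - by rewrite divr_gt0.
  - by apply: is_derive_eq (dV x0 t) _; field.
  - by apply: is_derive_add (is_derive_cst _ _ _) (dY t) _; rewrite add0r.
  - apply: is_derive_mul (is_derive_sub (is_derive_scale (dC t) erefl)
      (is_derive_scale (dS t) erefl) erefl) (is_derive_inv (e0 t) (de t) erefl) _.
    apply: (@mulIf _ (e t ^+ 2)); first by rewrite expf_neq0.
    have [_ CS1] := CS t.
    transitivity (- w0 ^+ 2 * (C t ^+ 2 - k ^+ 2 * S t ^+ 2)); last first.
      by rewrite CS1; field.
    transitivity ((k ^+ 2 * S t - u0 * C t) ^+ 2 +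
      (u0 * (k ^+ 2 * S t) - k ^+ 2 * C t) * e t); first by field.
    by rewrite k2 /e; ring.
  - by apply: is_derive_eq (dV w0 t) _; field.
move=> I x y u w itvI It0 flow [xt0 yt0 ut0 wt0].
have cst_on (f : R -> R) : (forall t : R, I t -> is_derive t 1 f 0) ->
    forall t, I t -> f t = f t0.
  by move=> df t It; exact: (derive0_interval_cst itvI df It It0).
have energy t : I t -> u t ^+ 2 + w t ^+ 2 = k ^+ 2.
  move=> It; rewrite k2 -ut0 -wt0; move: t It.
  apply: (cst_on (fun s => u s ^+ 2 + w s ^+ 2)) => t It.
  have [_ _ _ du dw] := flow t It.
  apply: is_derive_add (is_derive_mul du du erefl) (is_derive_mul dw dw erefl) _.
  by ring.
have dxV (t : R) : I t -> is_derive t 1 (fun s => (x s)^-1) (- u t / x t).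
  move=> It; have [xt dx _ _ _] := flow t It.
  by apply: is_derive_inv (lt0r_neq0 xt) dx _; field; exact: lt0r_neq0.
(* [f1] and [f2] are the Wronskians of 1 / x with the two fundamental
   solutions; they determine 1 / x since C^2 - k^2 S^2 = 1. *)
have f1 t : I t -> (C t + u t * S t) / x t = x0^-1.
  move=> It; transitivity ((C t0 + u t0 * S t0) / x t0); last first.
    by rewrite Ct0 St0 mulr0 addr0 xt0 mul1r.
  apply: (cst_on (fun s => (C s + u s * S s) / x s)) It => {}t It.
  have [xt _ _ du _] := flow t It.
  apply: is_derive_mul (is_derive_add (dC t) (is_derive_mul du (dS t) erefl) erefl) (dxV t It) _.
  by rewrite -(energy t It); field; exact: lt0r_neq0.
have f2 t : I t -> (u t * C t + k ^+ 2 * S t) / x t = u0 / x0.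
  move=> It; transitivity ((u t0 * C t0 + k ^+ 2 * S t0) / x t0); last first.
    by rewrite Ct0 St0 mulr0 addr0 xt0 mulr1 ut0.
  apply: (cst_on (fun s => (u s * C s + k ^+ 2 * S s) / x s)) It => {}t It.
  have [xt _ _ du _] := flow t It.
  apply: is_derive_mul (is_derive_add (is_derive_mul du (dC t) erefl)
     (is_derive_scale (dS t) erefl) erefl) (dxV t It) _.
  by rewrite -(energy t It); field; exact: lt0r_neq0.
have xE t : I t -> x t = x0 / e t.
  move=> It; have [/lt0r_neq0 xt _ _ _ _] := flow t It; have [_ CS1] := CS t.
  apply: (@mulIf _ (e t / (x0 * x t))).
    by rewrite mulf_neq0// invr_neq0 ?mulf_neq0.
  transitivity (x0^-1 * C t - u0 / x0 * S t); first by rewrite /e; field; apply/andP.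
  rewrite -(f2 t It) -(f1 t It).
  transitivity ((C t ^+ 2 - k ^+ 2 * S t ^+ 2) / x t); first by field.
  by rewrite CS1; field; rewrite x0_neq0 xt e0.
have wE t : I t -> w t / x t = w0 / x0.
  rewrite -wt0 -xt0; move: t; apply: (cst_on (fun s => w s / x s)) => t It.
  have [xt _ _ _ dw] := flow t It.
  by apply: is_derive_mul dw (dxV t It) _; field; exact: lt0r_neq0.
move=> t It; split; first exact: xE.
apply: (@addIr _ (- (w0 * x0 * (S t / e t)))); rewrite addrK.
transitivity (y t0 - w0 * x0 * (S t0 / e t0)); last first.
  by rewrite yt0 St0 mul0r mulr0 subr0.
apply: (cst_on (fun s => y s - w0 * x0 * (S s / e s))) It => {}t It.
have [/lt0r_neq0 xt _ dy _ _] := flow t It.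
apply: is_derive_sub dy (dY t) _.
have -> : w t = w0 / x0 * x t by rewrite -(wE t It); field.
by rewrite xE//; field; rewrite e0.
Qed.
End HalfPlane.

(** * Completeness *)

Section Completeness.
Context {R : realType}.
Context (g : 'rV[R]_2 -> 'M[R]_2) (g_inv : left_invariant g).
Context (ug : g aff_one \in unitmx) (symg : (g aff_one)^T = g aff_one).
Let B := g aff_one.

Lemma det2_gt0_definite : 0 < det2 B -> definite_metric affp g.
Proof.
move=> D0.
have gE p v : affp p -> v != 0 ->
    exists2 k, 0 < k & bilin (g p) v v = k * B 1 1 * (B 1 1 * bilin B v v).
  move=> p0 v0; exists ((p 0 0 * B 1 1) ^- 2).
    by rewrite invr_gt0 exprn_even_gt0//= mulf_neq0 ?det2_gt0_diag// gt_eqF.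
  rewrite left_invariant_scale// bilinZl -/B; field.
  by rewrite det2_gt0_diag// gt_eqF.
have [c0|c0|c0] := ltrgtP (B 1 1) 0; last first.
- by have := det2_gt0_diag D0; rewrite c0 eqxx.
- left=> p p0 v v0; have [k k0 ->] := gE p v p0 v0.
  by rewrite mulr_gt0 ?det2_gt0_form// mulr_gt0.
- right=> p p0 v v0; have [k k0 ->] := gE p v p0 v0.
  by rewrite nmulr_rlt0 ?det2_gt0_form// pmulr_rlt0.
Qed.

Lemma det2_lt0_not_definite : det2 B < 0 -> ~ definite_metric affp g.
Proof.
move=> /(isotropic_direction symg)[n n0 Bn].
have e1 : affp (@aff_one R) by rewrite /affp/= mxE ltr01.
have n_neq0 : n != 0.
  by apply: contra_eqN n0 => /eqP ->; rewrite mxE eq_sym oner_eq0.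
by move=> [/(_ _ e1 n n_neq0)|/(_ _ e1 n n_neq0)]; rewrite Bn ltxx.
Qed.

(** Isotropic lines are geodesics up to parametrisation. Along the direction [n]
    the affine parameter is t |-> - 1 / t for t < 0: this geodesic leaves every
    compact set as t tends to 0, so it has no extension past 0. *)
Lemma det2_lt0_incomplete : det2 B < 0 -> ~ geodesically_complete affp g.
Proof.
move=> /(isotropic_direction symg)[n n0 Bn] complete.
pose I : set R := [set t | t < 0].
pose c (t : R) := - t^-1 *: n.
have c0 t : c t 0 0 = - t^-1 by rewrite mxE n0 mulr1.
have geo_c : geodesic affp g I c.
  apply: (@euler_arnold_geodesic _ _ g_inv ug symg _ _ c).
  - by exists (-1); rewrite /I/= oppr_lt0 ltr01.
  - exact: open_lt.
  - by move=> s t _ t0 r /andP[_ rt]; exact: le_lt_trans rt t0.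
  move=> t t0; rewrite c0; split; first by rewrite oppr_gt0 invr_lt0.
  move=> k; rewrite bilinZZ Bn !mulr0 subr0.
  suff : is_derive t 1 (fun s => c s 0 k) (- t^-1 * c t 0 k) by [].
  under eq_fun do rewrite /c mxE mulNr mulrC -mulNr.
  have t_neq0 : t != 0 by rewrite lt_eqF.
  apply: is_derive_scale (is_derive_inv t_neq0 (is_derive_id _ _) erefl) _.
  by rewrite mxE; field.
have : I = setT.
  apply: (complete I c); split=> // J d [[_ _ itvJ] [_ sd _]] IJ dc.
  apply/seteqP; split=> // t Jt; rewrite /I/= ltNge; apply/negP => t0.
  have J0 : J 0.
    have I1 : I (-1) by rewrite /I/= oppr_lt0 ltr01.
    by apply: (itvJ (-1) t (IJ _ I1) Jt); rewrite t0 oppr_le0 ler01.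
  (* The product of t and the first coordinate is -1 for t < 0, but it
     would tend to 0 at 0. *)
  have /derivable_mxP/(_ 0 0) /derivable1_diffP/differentiable_continuous dd := sd 0%N 0 J0.
  have f0 : (fun s : R => d s 0 0 * s) s @[s --> 0] --> d 0 0 0 * 0.
    by apply: cvgM => //; exact: cvg_id.
  have : \forall s \near (0 : R), -1 < d s 0 0 * s.
    by apply: (cvgr_gt _ f0); rewrite mulr0 oppr_lt0.
  move=> /nbhs_ballP[e /= e0 /(_ (- (e / 2)))].
  rewrite /ball/= sub0r opprK gtr0_norm ?divr_gt0// ltr_pdivrMr// ltr_pMr// ltr1n.
  have Ie : I (- (e / 2)) by rewrite /I/= oppr_lt0 divr_gt0.
  move=> /(_ isT); rewrite dc// c0 mulNr mulVf ?ltxx//.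
  by rewrite oppr_eq0 gt_eqF// divr_gt0.
move=> /seteqP[_ /(_ 0 Logic.I)]; by rewrite /I/= ltxx.
Qed.

(** The linear map (x, y) |-> (x, (B11 y + B01 x) / sqrt (det B)) turns the
    metric, up to a constant factor, into the hyperbolic one. An inextensible
    geodesic is therefore the restriction of an explicit geodesic defined for all
    times, hence equal to it. *)
Lemma det2_gt0_complete : 0 < det2 B -> geodesically_complete affp g.
Proof.
move=> D0 I c [geo_c maxI].
have [[t0 It0] oI itvI] := geo_c.1.
have [z eaz] := geodesic_euler_arnold g_inv ug symg geo_c.
have D0' := lt0r_neq0 D0.
pose a : R := B 1 1; pose b : R := B 0 1.
pose s : R := Num.sqrt (det2 B).
have s2 : s ^+ 2 = det2 B by rewrite sqr_sqrtr// ltW.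
have s0 : s != 0 by rewrite gt_eqF// sqrtr_gt0.
have a0 : a != 0 := det2_gt0_diag D0.
have [i0 i1] := invmx_col0 symg ug; rewrite -/B -/a -/b in i0 i1.
(* [tr] is the new second coordinate, on points and on velocities alike. *)
pose tr (h : R -> 'rV[R]_2) (t : R) : R := s^-1 * (a * h t 0 1 + b * h t 0 0).
have dtr (h : R -> 'rV[R]_2) (t d0 d1 d : R) : is_derive t 1 (fun r => h r 0 0) d0 ->
    is_derive t 1 (fun r => h r 0 1) d1 -> s^-1 * (a * d1 + b * d0) = d ->
    is_derive t 1 (tr h) d.
  move=> dh0 dh1 <-; have dsum := is_derive_add (is_derive_scale (a := a) dh1 erefl)
    (is_derive_scale (a := b) dh0 erefl) erefl.
  exact: is_derive_scale dsum erefl.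
have qE h t : bilin B (h t) (h t) = det2 B / a * (h t 0 0 ^+ 2 + tr h t ^+ 2).
  apply: (mulfI a0); rewrite bilin2_square// -/a -/b -s2 /tr.
  by field; rewrite ?a0 ?s0 ?D0'.
have flow : half_plane_flow I (fun t => c t 0 0) (tr c) (fun t => z t 0 0) (tr z).
  move=> t It; have [x0 dcz] := eaz t It.
  have [dc0 dz0] := dcz 0; have [dc1 dz1] := dcz 1.
  split=> //.
  - by apply: dtr dc0 dc1 _; rewrite /tr; ring.
  - by apply: is_derive_eq dz0 _; rewrite -/B i0 qE; field; rewrite ?a0 ?s0 ?D0'.
  - by apply: dtr dz0 dz1 _; rewrite -/B i0 i1 qE /tr; field; rewrite ?a0 ?s0 ?D0'.
have [X [Y [U [W [flowT uniq]]]]] := half_plane_flow_complete t0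
  (tr c t0) (z t0 0 0) (tr z t0) (eaz t0 It0).1.
have {}uniq := uniq _ _ _ _ _ itvI It0 flow (And4 erefl erefl erefl erefl).
pose untr (f h : R -> R) (t : R) : 'rV[R]_2 :=
  \row_i if i == 0 then f t else a^-1 * (s * h t - b * f t).
have trK f h t : tr (untr f h) t = h t.
  by rewrite /tr !mxE/=; field; rewrite ?a0 ?s0 ?D0'.
have duntr (f h : R -> R) (t df dh d : R) k : is_derive t 1 f df -> is_derive t 1 h dh ->
    (if k == 0 then df else a^-1 * (s * dh - b * df)) = d ->
    is_derive t 1 (fun r => untr f h r 0 k) d.
  move=> dft dht <-; under eq_fun do rewrite mxE.
  case: ifP => // _.
  have dsub := is_derive_sub (is_derive_scale (a := s) dht erefl)
    (is_derive_scale (a := b) dft erefl) erefl.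
  exact: is_derive_scale dsub erefl.
have eaT : euler_arnold B setT (untr X Y) (untr U W).
  move=> t _; have [X0 dX dY dU dW] := flowT t Logic.I.
  rewrite qE trK; split=> [|k]; first by rewrite mxE.
  split.
  - apply: duntr dX dY _; rewrite !mxE/=.
    by case: ifP => // _; ring.
  - apply: duntr dU dW _; rewrite !mxE/=.
    by case: (ord2E k) => -> /=; rewrite -/B ?i0 ?i1; field; rewrite ?a0 ?s0 ?D0'.
have geoT : geodesic affp g setT (untr X Y).
  apply: (euler_arnold_geodesic g_inv ug symg _ _ _ eaT) => //.
  - by exists 0.
  - exact: openT.
rewrite (maxI _ _ geoT)// => t It; have [Xt Yt] := uniq t It.
apply/rowP => k; rewrite mxE -Xt -Yt; case: (ord2E k) => -> //=.
by rewrite /tr; field; rewrite ?a0 ?s0 ?D0'.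
Qed.

End Completeness.

Theorem corollary1p2 (R : realType) (g : 'rV[R]_2 -> 'M[R]_2)
  (g_metric : semi_riemannian_metric affp g) (g_inv : left_invariant g) :
  geodesically_complete affp g <-> definite_metric affp g.
Proof.
have e1 : affp (@aff_one R) by rewrite /affp/= mxE ltr01.
have [_ /(_ _ e1) symg /(_ _ e1) /nondegenerate_unitmx ug _] := g_metric.
have := det2_neq0 symg ug; rewrite neq_lt => /orP[D0|D0]; split.
- by move=> /(det2_lt0_incomplete g_inv ug symg D0).
- by move=> /(det2_lt0_not_definite symg D0).
- by move=> _; exact: det2_gt0_definite.
- by move=> _; exact: det2_gt0_complete.
Qed.
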